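(* For every integer $n \geq 5$, if $W_n$ is the wheel of order $n$, then $d(W_n) = \lceil \frac{n}{2} \rceil$.
   Context: Graphs are finite and simple. The wheel $W_n$ of order $n$ has $n$ vertices: a cycle on $n-1$ vertices together with one further vertex adjacent to all vertices of the cycle. The deduction game on a graph $G$: a layout is a placement of searchers on vertices of $G$ (a vertex may receive several searchers). A vertex is occupied in the layout if it contains at least one searcher, and unoccupied otherwise. A vertex is protected if it is occupied in the initial layout or if a searcher has moved there at some point, and unprotected otherwise. A vertex is fireable if the number of searchers on it is greater than or equal to the number of its unprotected neighbours. Initially every searcher is mobile; once a searcher has moved once, it becomes immobile (cannot move again). At each stage, simultaneously, for every fireable vertex $v$ containing mobile searchers, one searcher moves from $v$ to each unprotected neighbour of $v$ (excess searchers stay on $v$; several fireable vertices may send a searcher to the same target). Stages continue until no new searchers move. The layout is successful if at the end all vertices of $G$ are protected. The deduction number $d(G)$ is the minimum number of searchers in a successful layout on $G$. *)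

(* Defs.v *)
From mathcomp Require Import all_boot.

Set Implicit Arguments.
Unset Strict Implicit.
Unset Printing Implicit Defensive.

Record sgraph := SGraph {
  vertex :> finType;
  adj : rel vertex;
  adj_sym : symmetric adj;
  adj_irr : irreflexive adj
}.

Section Wheel.

Variable n : nat.

(* [Some i] is the i-th rim vertex and [None] is the hub.  The rim is a cycle
   of length n.-1 as soon as 4 <= n. *)
Definition wheel_adj (x y : option 'I_n.-1) : bool :=
  match x, y with
  | Some i, Some j => (i != j) && ((j == ordS i) || (i == ordS j))
  | None, None => false
  | _, _ => true
  end.

Lemma wheel_adj_sym : symmetric wheel_adj.
Proof. by move=> [i|] [j|] //=; rewrite eq_sym orbC. Qed.

Lemma wheel_adj_irr : irreflexive wheel_adj.
Proof. by move=> [i|] //=; rewrite eqxx. Qed.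

Definition wheel : sgraph := SGraph wheel_adj_sym wheel_adj_irr.

End Wheel.

Section DeductionGame.

Variable G : sgraph.

Definition layout := {ffun G -> nat}.

Definition searchers (L : layout) : nat := \sum_(v : G) L v.

Record state := State {
  mobile : {ffun G -> nat};
  immobile : {ffun G -> nat};
  protected : {set G}
}.

Definition start (L : layout) : state :=
  State L [ffun=> 0] [set v | 0 < L v].

Definition unprotected_nbrs (s : state) (v : G) : {set G} :=
  [set w | adj v w & w \notin protected s].

Definition fireable (s : state) (v : G) : bool :=
  #|unprotected_nbrs s v| <= mobile s v + immobile s v.

Definition fires (s : state) (v : G) : bool :=
  fireable s v && (0 < mobile s v).

(* Searchers only ever move to unprotected, hence empty, vertices, so no vertex
   holds mobile and immobile searchers at once (lemma [mobile_immobile]); the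
   subtraction below is therefore never truncated. *)
Definition stage (s : state) : state :=
  State
    [ffun v => if fires s v then mobile s v - #|unprotected_nbrs s v|
               else mobile s v]
    [ffun w => immobile s w
               + #|[set v | fires s v & w \in unprotected_nbrs s v]|]
    (protected s :|: \bigcup_(v | fires s v) unprotected_nbrs s v).

Definition stalled (s : state) : bool :=
  [forall v, fires s v ==> (unprotected_nbrs s v == set0)].

(* Every stage in which a searcher moves protects a new vertex, so #|G| stages
   are enough to reach the end of the game (lemma [final_stalled]). *)
Definition final (L : layout) : state := iter #|G| stage (start L).

Definition successful (L : layout) : bool := protected (final L) == setT.

Lemma stage_stalled s : stalled s -> stage s = s.
Proof.
move=> /forallP st.
have U0 v : fires s v -> unprotected_nbrs s v = set0.
  by move=> fv; apply/eqP; move/implyP: (st v); apply.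
case: s U0 {st} => m i p U0; rewrite /stage /=; congr State.
- apply/ffunP=> v; rewrite ffunE; case: ifP => // /U0 ->.
  by rewrite cards0 subn0.
- apply/ffunP=> w; rewrite ffunE (_ : [set _ | _ & _] = set0) ?cards0 ?addn0 //.
  apply/setP=> v; rewrite !inE; apply/negP=> /andP[/U0 /setP/(_ w)].
  by rewrite !inE => ->.
- by rewrite big1 ?setU0 // => v /U0.
Qed.

Lemma stage_moves s : ~~ stalled s -> #|protected s| < #|protected (stage s)|.
Proof.
rewrite negb_forall => /existsP[v]; rewrite negb_imply => /andP[fv /set0Pn[w wU]].
apply: proper_card; rewrite properE subsetUl /=; apply/subsetPn; exists w.
  by rewrite inE; apply/orP; right; apply/bigcupP; exists v.
by move: wU; rewrite inE => /andP[].
Qed.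

Lemma final_stalled L : stalled (final L).
Proof.
have H k : stalled (iter k stage (start L))
           || (k <= #|protected (iter k stage (start L))|).
  elim: k => [|k IH]; first by rewrite orbT.
  rewrite iterS; have [st|nst] := boolP (stalled (iter k stage (start L))).
    by rewrite stage_stalled // st.
  move: IH; rewrite (negPf nst) /= => IH.
  by rewrite (leq_trans _ (stage_moves nst)) ?orbT.
have /orP[//|full] := H #|G|; apply/forallP=> v; apply/implyP=> _.
have pT : protected (final L) = setT.
  by apply/eqP; rewrite eqEcard subsetT cardsT.
by apply/eqP/setP=> w; rewrite !inE pT inE andbF.
Qed.

Lemma mobile_immobile L k v (s := iter k stage (start L)) :
  mobile s v = 0 \/ immobile s v = 0.
Proof.
suff [//] : (mobile s v = 0 \/ immobile s v = 0)
         /\ (v \notin protected s -> mobile s v = 0).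
rewrite {}/s; elim: k => [|k]; rewrite ?iterS.
  rewrite /= !inE !ffunE; split; first by right.
  by rewrite lt0n negbK => /eqP.
set s := iter k stage _ => -[mi mp] /=; rewrite !inE !ffunE.
have m0 : mobile s v = 0 -> fires s v = false.
  by rewrite /fires => ->; rewrite andbF.
split.
  have [vp|/mp mv] := boolP (v \in protected s); last by left; rewrite m0.
  case: mi => [mv|iv]; first by left; rewrite m0.
  right; rewrite iv add0n (_ : [set _ | _ & _] = set0) ?cards0 //.
  by apply/setP=> w; rewrite !inE vp !andbF.
by rewrite negb_or => /andP[/mp mv _]; rewrite m0.
Qed.

(* Boolean form of "some layout with k searchers is successful": in such a
   layout no vertex carries more than k searchers. *)
Definition clearable (k : nat) : bool :=
  [exists f : {ffun G -> 'I_k.+1},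
     let L : layout := [ffun v => val (f v)] in
     (searchers L == k) && successful L].

Lemma clearableP k :
  reflect (exists2 L : layout, searchers L = k & successful L) (clearable k).
Proof.
apply: (iffP existsP) => [[f /andP[/eqP fk ok]]|[L Lk ok]].
  by exists [ffun v => val (f v)].
have Lle v : L v < k.+1 by rewrite ltnS -Lk /searchers (bigD1 v) //= leq_addr.
exists [ffun v => Ordinal (Lle v)].
have -> /= : [ffun v => val ([ffun v => Ordinal (Lle v)] v)] = L.
  by apply/ffunP=> v; rewrite !ffunE.
by rewrite Lk eqxx.
Qed.

Lemma protected_iter k s : protected s \subset protected (iter k stage s).
Proof. by elim: k => // k IH; apply: subset_trans IH (subsetUl _ _). Qed.

Lemma clearable_ex : exists k, clearable k.
Proof.
exists (searchers [ffun=> 1]); apply/clearableP; exists [ffun=> 1] => //.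
rewrite /successful eqEsubset subsetT (subset_trans _ (protected_iter _ _)) //.
by apply/subsetP=> v _; rewrite !inE ffunE.
Qed.

Definition deduction_number : nat := ex_minn clearable_ex.

End DeductionGame.

(* Main.v *)
Require Import Defs.
From mathcomp Require Import all_boot zify.

Set Implicit Arguments.
Unset Strict Implicit.
Unset Printing Implicit Defensive.

(** Lower bound, on any graph: a searcher protects at most two vertices, the one
    it starts on and the one it moves to, so a successful layout with k searchers
    lives on a graph with at most 2k vertices ([card_successful]).

    Upper bound, on the wheel: number the rim 0, ..., m with m = n - 2, and put
    one searcher on 1 and one on each even i < m.  Vertex 1 sits between the
    occupied vertices 0 and 2, so its searcher moves to the hub.  Once the hub is
    protected, the searcher on 0 only has m left to protect; the searcher on 2
    moves to 3, after which the one on 4 moves to 5, and so on around the rim.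
    There are ceil(m/2) + 1 = ceil(n/2) searchers.

    The upper bound is argued on the final state, without counting stages: an
    initially occupied vertex cannot end with exactly one unprotected neighbour,
    for it would either still hold all its searchers and be able to fire, or
    have fired and thereby protected all its neighbours ([last_nbr_protected]).
    The chain of moves above becomes a chain of such deductions. *)

Lemma leq_card_bigcup (I T : finType) (P : pred I) (F : I -> {set T}) :
  #|\bigcup_(i | P i) F i| <= \sum_(i | P i) #|F i|.
Proof.
elim/big_rec2: _ => [|i a A _ IH]; first by rewrite cards0.
by apply: leq_trans (leq_card_setU _ _) _; rewrite leq_add2l.
Qed.

Section Game.
Variable G : sgraph.
Implicit Types (L : layout G) (s : state G).

(** Each vertex protected during a stage is paid for by a searcher that turns
    immobile; several searchers may move to the same vertex, whence the
    inequality.  Without the hypothesis the subtraction in [stage] could be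
    truncated, as [fireable] also counts immobile searchers. *)
Lemma protected_mobile_stage s :
    (forall v, mobile s v = 0 \/ immobile s v = 0) ->
  #|protected (stage s)| + \sum_v mobile (stage s) v
    <= #|protected s| + \sum_v mobile s v.
Proof.
move=> mi /=.
have -> : \sum_v mobile s v
   = \sum_(v | fires s v) #|unprotected_nbrs s v| + \sum_v mobile (stage s) v.
  rewrite [X in X + _]big_mkcond -big_split; apply: eq_bigr => v _ /=.
  rewrite ffunE; case: ifP => // /andP[fv m0]; rewrite subnKC //.
  by case: (mi v) => e; move: fv m0; rewrite /fireable e ?addn0.
rewrite addnA leq_add2r (leq_trans (leq_card_setU _ _)) // leq_add2l.
exact: leq_card_bigcup.
Qed.

(** The potential of [protected_mobile_stage] starts at the number of occupied
    vertices plus the number of searchers, hence at most twice the latter. *)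
Lemma card_successful L : successful L -> #|G| <= (searchers L).*2.
Proof.
move=> /eqP fT.
suff H k : #|protected (iter k (@stage G) (start L))|
           + \sum_v mobile (iter k (@stage G) (start L)) v <= (searchers L).*2.
  by apply: leq_trans (H #|G|); rewrite -/(final L) fT cardsT leq_addr.
elim: k => [|k]; last first.
  by apply: leq_trans; apply: protected_mobile_stage => v; apply: mobile_immobile.
rewrite -addnn leq_add2r -sum1_card big_mkcond; apply: leq_sum => v _.
by rewrite inE; case: ifP.
Qed.

(** A vertex loses searchers only by firing, and firing protects all its
    neighbours at once and for good. *)
Lemma mobile_unprotected_iter L k v (s := iter k (@stage G) (start L)) :
  mobile s v = L v \/ unprotected_nbrs s v = set0.
Proof.
rewrite {}/s; elim: k => [|k]; first by left.
rewrite iterS; set s := iter k _ _ => IH.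
have [fv|nfv] := boolP (fires s v); last first.
  rewrite /= ffunE (negPf nfv).
  case: IH => [|e]; [by left | right].
  apply/eqP; rewrite -subset0 -e; apply/subsetP=> w.
  by rewrite !inE negb_or => /and3P[-> ->].
right; apply/setP=> w; rewrite !inE negb_or; apply/and3P=> -[vw wp /negP[]].
by apply/bigcupP; exists v; rewrite // inE vw.
Qed.

Lemma final_nbrs_protected L v :
    0 < L v -> #|unprotected_nbrs (final L) v| <= L v ->
  forall w, adj v w -> w \in protected (final L).
Proof.
move=> L0 le w vw; apply: contraT => wp.
have : w \in unprotected_nbrs (final L) v by rewrite inE vw.
have [e|->] := mobile_unprotected_iter L #|G| v; last by rewrite inE.
have fv : fires (final L) v.
  by rewrite /fires /fireable e L0 (leq_trans le) // leq_addr.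
by have /forallP/(_ v) := final_stalled L; rewrite fv => /eqP->; rewrite inE.
Qed.

(** One step of a chain of deductions: if all other neighbours of an occupied
    vertex end up protected, so does the remaining one. *)
Lemma last_nbr_protected L v w :
    0 < L v -> adj v w ->
    (forall u, adj v u -> u != w -> u \in protected (final L)) ->
  w \in protected (final L).
Proof.
move=> L0 vw H; apply: (final_nbrs_protected L0 _ vw); apply: leq_trans L0.
rewrite -(cards1 w); apply/subset_leq_card/subsetP=> u.
by rewrite !inE => /andP[vu]; apply: contraNT; apply: H.
Qed.

Lemma occupied_protected L v : 0 < L v -> v \in protected (final L).
Proof. by move=> L0; apply: (subsetP (protected_iter _ _)); rewrite inE. Qed.

End Game.

(** The last rim vertex n - 2 is left empty even when it is even: it is protected
    from its neighbour 0. *)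
Definition wheel_layout n : layout (wheel n) :=
  [ffun v : option 'I_n.-1 =>
     if v is Some i then ((i == 1 :> nat) || ~~ odd i && (i.+2 < n)) : nat
     else 0].

Lemma sum_even m : \sum_(i < m) ~~ odd i = uphalf m.
Proof.
elim: m => [|m IH]; first by rewrite big_ord0.
by rewrite big_ord_recr /= IH uphalf_half; lia.
Qed.

Lemma big_option (T : finType) (F : option T -> nat) :
  \sum_v F v = F None + \sum_i F (Some i).
Proof.
rewrite (bigD1 None) //=; congr (_ + _).
rewrite (reindex_omap Some id) => [|[]] //.
by apply: eq_bigl => i; rewrite /= eqxx.
Qed.

Lemma searchers_wheel_layout n : 3 < n -> searchers (wheel_layout n) = uphalf n.
Proof.
case: n => [|[|n]] // n1; rewrite /searchers big_option ffunE add0n.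
rewrite (eq_bigr (fun i : 'I_n.+1 => (i == 1 :> nat) + (~~ odd i && (i < n)))).
  have v1 : (inord 1 : 'I_n.+1) = 1 :> nat by rewrite inordK //; lia.
  rewrite big_split /= (bigD1 (inord 1 : 'I_n.+1)) //= v1 eqxx big1 => [|i].
    rewrite big_ord_recr /= ltnn andbF !addn0 add1n -sum_even; congr _.+1.
    by apply: eq_bigr => i _; rewrite ltn_ord andbT.
  by rewrite -val_eqE /= v1 => /negPf->.
by move=> i _; rewrite ffunE !ltnS; case: eqP => //= ->.
Qed.

Lemma val_ordS m (i : 'I_m.+1) : ordS i = (if i < m then i.+1 else 0) :> nat.
Proof.
rewrite /=; have := ltn_ord i; rewrite ltnS leq_eqVlt.
by case: ltngtP => //= [im _|-> _]; rewrite ?modnn // modn_small.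
Qed.

Lemma wheel_layout_successful n : 4 < n -> successful (wheel_layout n).
Proof.
case: n => [|[|m]] // m2; set L := wheel_layout _.
(* Rim vertices are indexed by naturals, so that adjacency is arithmetic. *)
pose rim j : wheel m.+2 := Some (inord j : 'I_m.+1).
have rimE (i : 'I_m.+1) : Some i = rim i by rewrite /rim inord_val.
have Lrim j : j <= m -> 0 < L (rim j) = (j == 1) || ~~ odd j && (j < m).
  by move=> jm; rewrite ffunE /= inordK // !ltnS lt0b.
have adj_rim i j : i <= m -> j <= m -> adj (rim i) (rim j) =
    [|| j == i.+1, i == j.+1, (i == 0) && (j == m) | (i == m) && (j == 0)].
  move=> im jm; rewrite /= -!val_eqE.
  have := val_ordS (inord i : 'I_m.+1); have := val_ordS (inord j : 'I_m.+1).
  by rewrite /= !inordK // => -> ->; case: (ltnP i m); case: (ltnP j m); lia.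
have occ j : j <= m -> (j == 1) || ~~ odd j && (j < m) ->
    rim j \in protected (final L).
  by move=> jm Hj; apply: occupied_protected; rewrite Lrim.
(* Both rim neighbours of 1 are occupied; here m >= 3 puts 2 before m. *)
have hub : None \in protected (final L).
  apply: (@last_nbr_protected _ _ (rim 1)) => [||[k|]] //.
    by rewrite Lrim //; lia.
  have km : k <= m by rewrite -ltnS.
  by rewrite rimE adj_rim //; [move=> a _; apply: occ; lia | lia].
have last_rim i j : i <= m -> j <= m -> (i == 1) || ~~ odd i && (i < m) ->
    adj (rim i) (rim j) ->
    (forall k, k <= m -> adj (rim i) (rim k) -> k != j ->
       rim k \in protected (final L)) ->
    rim j \in protected (final L).
  move=> im jm oi ij H; apply: (@last_nbr_protected _ _ (rim i)); [|exact: ij|].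
    by rewrite Lrim.
  case=> [k|] ik kj; last exact: hub.
  rewrite rimE; apply: H; [by rewrite -ltnS | by rewrite -rimE |].
  by apply: contraNneq kj => <-; rewrite rimE.
have prot j : j <= m -> rim j \in protected (final L).
  elim/ltn_ind: j => j IH jm.
  have [o|no] := boolP ((j == 1) || ~~ odd j && (j < m)); first exact: occ.
  have [e|ne] := eqVneq j m.
    (* The other rim neighbour of 0 is the occupied vertex 1. *)
    apply: (last_rim 0) => // [||k km]; rewrite ?adj_rim //; try lia.
    by move=> a kj; apply: occ; lia.
  (* Here j is odd, j >= 3 and j < m, so that j.-1 is even and occupied, and its
     other rim neighbour j - 2 comes earlier in the induction. *)
  apply: (last_rim j.-1) => // [|||k km]; rewrite ?adj_rim //; try lia.
  by move=> a kj; apply: IH; lia.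
by apply/eqP/setP=> -[i|]; rewrite !inE // rimE prot // -ltnS.
Qed.

Theorem theorem4p3 (n : nat) (hn : 5 <= n) :
  deduction_number (wheel n) = uphalf n.
Proof.
rewrite /deduction_number; case: ex_minnP => d /clearableP[L <- okL] min.
apply/eqP; rewrite eqn_leq min /=.
  have := card_successful okL.
  by rewrite card_option card_ord prednK ?leq_uphalf_double //; lia.
apply/clearableP; exists (wheel_layout n); last exact: wheel_layout_successful.
by apply: searchers_wheel_layout; lia.
Qed.
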